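(* Let $R$ be a commutative unitary ring, let $n>0$, and let $K^*$ be the Koszul complex of a sequence $f_1,\dots,f_n\in R$: $$K^*\colon\qquad 0\to K^{-n}\to\cdots\to K^{-1}\to K^0,\qquad K^{-i}={\bigwedge}^iR^n.$$ If the ideal $(f_1,\dots,f_n)\subset R$ is proper, then the DG-Lie algebra $H=\operatorname{Hom}^*_R(K^*,K^* )$ is not homotopy abelian over $R$.
   Context: A DG-Lie algebra over a commutative ring $R$ is a cochain complex $(L,d)$ of $R$-modules with an $R$-bilinear bracket $[-,-]\colon L\times L\to L$ such that, for homogeneous elements (with $\bar a$ the degree of $a$): $[L^i,L^j]\subset L^{i+j}$; $[a,b]+(-1)^{\bar a\bar b}[b,a]=0$; $[a,a]=0$ for $a$ of even degree; $d[a,b]=[da,b]+(-1)^{\bar a}[a,db]$; $[a,[b,c]]=[[a,b],c]+(-1)^{\bar a\bar b}[b,[a,c]]$; $[b,[b,b]]=0$ for $b$ of odd degree. Morphisms are morphisms of complexes of $R$-modules commuting with brackets. It is abelian if the bracket is zero. A DG-Lie algebra $L$ over $R$ is homotopy abelian (over $R$) if there is a finite zigzag $L\leftarrow L_1\to L_2\leftarrow L_3\to\cdots\leftarrow L_n\to M$ of morphisms of DG-Lie algebras over $R$, all of which are quasi-isomorphisms, with $M$ abelian. For a complex $K^*$ of $R$-modules, $\operatorname{Hom}^*_R(K^*,K^* )$ is the DG-Lie algebra of graded $R$-linear endomorphisms of $K^*$, with bracket the graded commutator $[\phi,\psi]=\phi\psi-(-1)^{\bar\phi\bar\psi}\psi\phi$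 and differential the graded commutator with the differential of $K^*$. *)

(* Defs.v *)
From HB Require Import structures.
From mathcomp Require Import all_boot all_order all_algebra.
From mathcomp Require Import boolp zify.

Set Implicit Arguments.
Unset Strict Implicit.
Unset Printing Implicit Defensive.

Import GRing.Theory.
Local Open Scope ring_scope.

(* Degrees are arbitrary integers.  Operations changing the degree take the   *)
(* target degree together with an equation identifying it (for instance       *)
(* [i + j = k]), so that no transport between [L (i + j)] and [L (j + i)] is  *)
(* ever needed; proofs of equations in [int] are unique.                      *)

Definition sgn (R : comPzRingType) (i : int) : R := (-1) ^+ absz i.

Record cochain_complex (R : comPzRingType) := CochainComplex {
  cpx :> int -> lmodType R;
  dif : forall i j : int, i + 1 = j -> {linear cpx i -> cpx j};
  dif_dif : forall (i j k : int) (ij : i + 1 = j) (jk : j + 1 = k) x,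
    dif jk (dif ij x) = 0 }.

Record dglie (R : comPzRingType) := DGLie {
  dgl_cpx :> cochain_complex R;
  brk : forall i j k : int, i + j = k -> dgl_cpx i -> dgl_cpx j -> dgl_cpx k;
  brk_linearl : forall (i j k : int) (h : i + j = k) b, linear (fun a => brk h a b);
  brk_linearr : forall (i j k : int) (h : i + j = k) a, linear (brk h a);
  brk_anti : forall (i j k : int) (h : i + j = k) (h' : j + i = k) a b,
    brk h a b + sgn R (i * j) *: brk h' b a = 0;
  brk_even : forall (i k : int) (h : i + i = k) a, ~~ odd (absz i) -> brk h a a = 0;
  brk_leibniz : forall (i j k i' j' k' : int)
      (ij : i + j = k) (kk' : k + 1 = k') (ii' : i + 1 = i') (jj' : j + 1 = j')
      (i'j : i' + j = k') (ij' : i + j' = k') a b,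
    dif dgl_cpx kk' (brk ij a b)
    = brk i'j (dif dgl_cpx ii' a) b + sgn R i *: brk ij' a (dif dgl_cpx jj' b);
  brk_jacobi : forall (i j k ij ik jk n : int)
      (eij : i + j = ij) (eik : i + k = ik) (ejk : j + k = jk)
      (en1 : i + jk = n) (en2 : ij + k = n) (en3 : j + ik = n) a b c,
    brk en1 a (brk ejk b c)
    = brk en2 (brk eij a b) c + sgn R (i * j) *: brk en3 b (brk eik a c);
  brk_odd : forall (i j k : int) (h : i + i = j) (h' : i + j = k) b,
    odd (absz i) -> brk h' b (brk h b b) = 0 }.

Record dgl_morphism (R : comPzRingType) (L M : dglie R) := DGLMorphism {
  dgl_map :> forall i : int, {linear L i -> M i};
  dgl_map_dif : forall (i j : int) (h : i + 1 = j) a,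
    dgl_map j (dif L h a) = dif M h (dgl_map i a);
  dgl_map_brk : forall (i j k : int) (h : i + j = k) a b,
    dgl_map k (brk h a b) = brk h (dgl_map i a) (dgl_map j b) }.

Definition cocycle (R : comPzRingType) (K : cochain_complex R) (i : int)
    (x : K i) :=
  forall (j : int) (h : i + 1 = j), dif K h x = 0.

(* Equality of classes in the cohomology module H^i(K). *)
Definition cohomologous (R : comPzRingType) (K : cochain_complex R) (i : int)
    (x y : K i) :=
  exists (j : int) (h : j + 1 = i) z, x - y = dif K h z.

(* The maps induced on H^i are injective and surjective for all i. *)
Definition quasi_iso (R : comPzRingType) (L M : dglie R)
    (f : dgl_morphism L M) :=
  forall i : int,
    (forall x y : L i, cocycle x -> cocycle y ->
       cohomologous (f i x) (f i y) -> cohomologous x y) /\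
    (forall y : M i, cocycle y ->
       exists2 x : L i, cocycle x & cohomologous (f i x) y).

Definition abelian_dgl (R : comPzRingType) (L : dglie R) :=
  forall (i j k : int) (h : i + j = k) (a : L i) (b : L j), brk h a b = 0.

(* [L <- L1 -> L2 <- ... <- Ln -> M], as a nonempty sequence of spans. *)
Inductive qi_zigzag (R : comPzRingType) (L M : dglie R) : Prop :=
| QiSpan (N : dglie R) (f : dgl_morphism N L) (g : dgl_morphism N M) of
    quasi_iso f & quasi_iso g
| QiStep (N L' : dglie R) (f : dgl_morphism N L) (g : dgl_morphism N L') of
    quasi_iso f & quasi_iso g & qi_zigzag L' M.

Definition homotopy_abelian (R : comPzRingType) (L : dglie R) :=
  exists2 M : dglie R, abelian_dgl M & qi_zigzag L M.

Section Sign.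
Variable R : comPzRingType.
Local Notation sg := (sgn R).

Lemma odd_abszD (i j : int) :
  odd (absz (i + j)) = odd (absz i) (+) odd (absz j).
Proof. lia. Qed.

Lemma odd_abszM (i j : int) :
  odd (absz (i * j)) = odd (absz i) && odd (absz j).
Proof. by rewrite abszM oddM. Qed.

Lemma sgnE i : sg i = (-1) ^+ odd (absz i).
Proof. by rewrite /sgn signr_odd. Qed.

Lemma sgnD i j : sg (i + j) = sg i * sg j.
Proof. by rewrite !sgnE odd_abszD signr_addb. Qed.

Lemma sgnMM i : sg i * sg i = 1.
Proof. by rewrite !sgnE -signr_addb addbb. Qed.

Lemma sgn1 : sg 1 = -1. Proof. by []. Qed.

Lemma sgn_even i : ~~ odd (absz i) -> sg i = 1.
Proof. by rewrite sgnE => /negbTE->. Qed.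

Lemma sgn_oddE i : odd (absz i) -> sg i = -1.
Proof. by rewrite sgnE => ->. Qed.

End Sign.

Section GradedHom.
Variable R : comPzRingType.
Implicit Types A B C D : int -> lmodType R.
Implicit Types i j k m n p q mn np : int.

(* Graded R-linear maps of degree m: no finiteness over i, i.e. the product   *)
(* of all Hom(A^i, B^(i+m)); no compatibility with differentials.             *)
Record ghom A B (m : int) := GHom {
  ghom_fun :> forall i j : int, i + m = j -> A i -> B j;
  ghom_linear : forall i j (h : i + m = j), linear (ghom_fun h) }.

HB.instance Definition _ A B m := gen_eqMixin (ghom A B m).
HB.instance Definition _ A B m := gen_choiceMixin (ghom A B m).

HB.instance Definition _ A B m (f : ghom A B m) i j (h : i + m = j) :=
  GRing.isLinear.Build R (A i) (B j) _ (f i j h) (ghom_linear f h).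

Lemma ghomP A B m (f g : ghom A B m) :
  (forall i j (h : i + m = j) x, f i j h x = g i j h x) -> f = g.
Proof.
case: f g => [f fl] [g gl] /= fg.
have E : f = g.
  apply: functional_extensionality_dep => i.
  apply: functional_extensionality_dep => j.
  apply: functional_extensionality_dep => h.
  by apply: functional_extensionality_dep => x; apply: fg.
by case: _ / E gl => gl; congr GHom; apply: Prop_irrelevance.
Qed.

Section Module.
Variables (A B : int -> lmodType R) (m : int).
Implicit Types f g : ghom A B m.

Fact ghom0_linear i j (h : i + m = j) : linear (fun _ : A i => 0 : B j).
Proof. by move=> a x y; rewrite scaler0 addr0. Qed.
Definition ghom0 : ghom A B m := GHom ghom0_linear.

Fact ghomN_linear f i j (h : i + m = j) : linear (fun x => - f i j h x).
Proof. by move=> a x y; rewrite linearP opprD scalerN. Qed.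
Definition ghomN f : ghom A B m := GHom (ghomN_linear f).

Fact ghomD_linear f g i j (h : i + m = j) :
  linear (fun x => f i j h x + g i j h x).
Proof. by move=> a x y; rewrite !linearP scalerDr addrACA. Qed.
Definition ghomD f g : ghom A B m := GHom (ghomD_linear f g).

Fact ghomZ_linear (c : R) f i j (h : i + m = j) :
  linear (fun x => c *: f i j h x).
Proof. by move=> a x y; rewrite linearP scalerDr !scalerA mulrC. Qed.
Definition ghomZ c f : ghom A B m := GHom (ghomZ_linear c f).

Fact ghomDA : associative ghomD.
Proof. by move=> f g k; apply: ghomP => i j h x /=; rewrite addrA. Qed.
Fact ghomDC : commutative ghomD.
Proof. by move=> f g; apply: ghomP => i j h x /=; rewrite addrC. Qed.
Fact ghom0D : left_id ghom0 ghomD.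
Proof. by move=> f; apply: ghomP => i j h x /=; rewrite add0r. Qed.
Fact ghomND : left_inverse ghom0 ghomN ghomD.
Proof. by move=> f; apply: ghomP => i j h x /=; rewrite addNr. Qed.

HB.instance Definition _ :=
  GRing.isZmodule.Build (ghom A B m) ghomDA ghomDC ghom0D ghomND.

Fact ghomZA a b f : ghomZ a (ghomZ b f) = ghomZ (a * b) f.
Proof. by apply: ghomP => i j h x /=; rewrite scalerA. Qed.
Fact ghom1Z : left_id 1 ghomZ.
Proof. by move=> f; apply: ghomP => i j h x /=; rewrite scale1r. Qed.
Fact ghomZDr : right_distributive ghomZ +%R.
Proof. by move=> c f g; apply: ghomP => i j h x /=; rewrite scalerDr. Qed.
Fact ghomZDl f : {morph ghomZ^~ f : a b / a + b}.
Proof. by move=> a b; apply: ghomP => i j h x /=; rewrite scalerDl. Qed.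

HB.instance Definition _ :=
  GRing.Zmodule_isLmodule.Build R (ghom A B m) ghomZA ghom1Z ghomZDr ghomZDl.

End Module.

Fact ghom_comp_subproof (i m n p j : int) :
  m + n = p -> i + p = j -> i + n + m = j.
Proof. by move=> <- <-; rewrite -addrA (addrC n). Qed.

Definition ghom_comp_fun A B C m n p (h : m + n = p)
    (f : ghom B C m) (g : ghom A B n) i j (hij : i + p = j) (x : A i) : C j :=
  f (i + n) j (ghom_comp_subproof h hij) (g i (i + n) erefl x).

Fact ghom_comp_linear A B C m n p (h : m + n = p)
    (f : ghom B C m) (g : ghom A B n) i j (hij : i + p = j) :
  linear (ghom_comp_fun h f g hij).
Proof. by move=> a x y; rewrite /ghom_comp_fun !linearP. Qed.

Definition ghom_comp A B C m n p (h : m + n = p)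
    (f : ghom B C m) (g : ghom A B n) : ghom A C p :=
  GHom (ghom_comp_linear h f g).

Lemma ghom_compE A B C m n p (h : m + n = p) (f : ghom B C m) (g : ghom A B n)
    i k j (hik : i + n = k) (hkj : k + m = j) (hij : i + p = j) x :
  ghom_comp h f g i j hij x = f k j hkj (g i k hik x).
Proof.
case: _ / hik hkj => hkj.
by rewrite /= /ghom_comp_fun (eq_irrelevance hkj (ghom_comp_subproof h hij)).
Qed.

Lemma ghom_compA A B C D m n p mn np q (emn : m + n = mn) (enp : n + p = np)
    (e1 : m + np = q) (e2 : mn + p = q)
    (f : ghom C D m) (g : ghom B C n) (h : ghom A B p) :
  ghom_comp e1 f (ghom_comp enp g h) = ghom_comp e2 (ghom_comp emn f g) h.
Proof.
apply: ghomP => i j hij x.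
have e3 : i + np + m = j by rewrite -hij -e1 -addrA (addrC np).
have e4 : i + p + mn = j by rewrite -hij -e2 -addrA (addrC p).
have e5 : i + p + n = i + np by rewrite -enp -addrA (addrC p).
rewrite (ghom_compE _ _ _ erefl e3) (ghom_compE _ _ _ erefl e5).
by rewrite (ghom_compE _ _ _ erefl e4) (ghom_compE _ _ _ e5 e3).
Qed.

Lemma ghom_comp_linearl A B C m n p (h : m + n = p) (g : ghom A B n) :
  linear (fun f : ghom B C m => ghom_comp h f g).
Proof. by move=> a f f'; apply: ghomP. Qed.

Lemma ghom_comp_linearr A B C m n p (h : m + n = p) (f : ghom B C m) :
  linear (fun g : ghom A B n => ghom_comp h f g).
Proof. by move=> a g g'; apply: ghomP => i j hij x; exact: linearP. Qed.

HB.instance Definition _ A B C m n p (h : m + n = p) (f : ghom B C m) :=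
  GRing.isLinear.Build R (ghom A B n) (ghom A C p) _ (ghom_comp h f)
    (ghom_comp_linearr h f).

Fact addzC_subproof (m n p : int) : m + n = p -> n + m = p.
Proof. by rewrite addrC. Qed.

Definition gcomm A m n p (h : m + n = p) (f : ghom A A m) (g : ghom A A n) :
    ghom A A p :=
  ghom_comp h f g - sgn R (m * n) *: ghom_comp (addzC_subproof h) g f.

Lemma gcomm_linearl A m n p (h : m + n = p) (g : ghom A A n) :
  linear (fun f : ghom A A m => gcomm h f g).
Proof.
move=> a f f'; rewrite /gcomm ghom_comp_linearl linearP.
by rewrite !scalerBr scalerDr !scalerA opprD addrACA (mulrC a).
Qed.

Lemma gcomm_linearr A m n p (h : m + n = p) (f : ghom A A m) :
  linear (@gcomm A m n p h f).
Proof.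
move=> a g g'; rewrite /gcomm ghom_comp_linearl linearP.
by rewrite !scalerBr scalerDr !scalerA opprD addrACA (mulrC a).
Qed.

HB.instance Definition _ A m n p (h : m + n = p) (f : ghom A A m) :=
  GRing.isLinear.Build R (ghom A A n) (ghom A A p) _ (gcomm h f)
    (gcomm_linearr h f).

Lemma gcommE A m n p (h : m + n = p) (h' : n + m = p)
    (f : ghom A A m) (g : ghom A A n) :
  gcomm h f g = ghom_comp h f g - sgn R (m * n) *: ghom_comp h' g f.
Proof. by rewrite /gcomm (eq_irrelevance h' (addzC_subproof h)). Qed.

Lemma gcomm_anti A m n p (h : m + n = p) (h' : n + m = p)
    (f : ghom A A m) (g : ghom A A n) :
  gcomm h f g + sgn R (m * n) *: gcomm h' g f = 0.
Proof.
rewrite (gcommE h h') (gcommE h' h) (mulrC n) scalerBr scalerA sgnMM scale1r.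
by rewrite addrA subrK subrr.
Qed.

Lemma gcomm_even A m p (h : m + m = p) (f : ghom A A m) :
  ~~ odd (absz m) -> gcomm h f f = 0.
Proof.
move=> em; rewrite (gcommE h h) sgn_even ?scale1r ?subrr //.
by rewrite odd_abszM andbb.
Qed.

Fact jacobi_zmod (V : zmodType) (x1 x2 x3 x4 y z : V) :
  (x1 - x2) - (x3 - x4) = ((x1 - y) - (z - x4)) + ((y - x3) - (x2 - z)).
Proof.
rewrite [RHS]addrACA subrKA (opprB z) (opprB x2) subrKA opprB.
by rewrite (addrACA x1) (addrACA x1 (- x3)) (addrC (- x3)).
Qed.

Lemma ghom_compBl A B C m n p (h : m + n = p) (f f' : ghom B C m)
    (g : ghom A B n) :
  ghom_comp h (f - f') g = ghom_comp h f g - ghom_comp h f' g.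
Proof. by apply: ghomP. Qed.

Lemma ghom_compDl A B C m n p (h : m + n = p) (f f' : ghom B C m)
    (g : ghom A B n) :
  ghom_comp h (f + f') g = ghom_comp h f g + ghom_comp h f' g.
Proof. by apply: ghomP. Qed.

Lemma ghom_comp0l A B C m n p (h : m + n = p) (g : ghom A B n) :
  ghom_comp h (0 : ghom B C m) g = 0.
Proof. by apply: ghomP. Qed.

Lemma ghom_compZl A B C m n p (h : m + n = p) c (f : ghom B C m)
    (g : ghom A B n) :
  ghom_comp h (c *: f) g = c *: ghom_comp h f g.
Proof. by apply: ghomP. Qed.

Lemma gcomm_jacobi A i j k ij ik jk n
    (eij : i + j = ij) (eik : i + k = ik) (ejk : j + k = jk)
    (en1 : i + jk = n) (en2 : ij + k = n) (en3 : j + ik = n)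
    (a : ghom A A i) (b : ghom A A j) (c : ghom A A k) :
  gcomm en1 a (gcomm ejk b c)
  = gcomm en2 (gcomm eij a b) c + sgn R (i * j) *: gcomm en3 b (gcomm eik a c).
Proof.
have eji := addzC_subproof eij; have eki := addzC_subproof eik.
have ekj := addzC_subproof ejk; have en1' := addzC_subproof en1.
have en2' := addzC_subproof en2; have en3' := addzC_subproof en3.
rewrite (gcommE en1 en1') (gcommE ejk ekj) (gcommE en2 en2') (gcommE eij eji).
rewrite (gcommE en3 en3') (gcommE eik eki).
have -> : sgn R (i * jk) = sgn R (i * j) * sgn R (i * k).
  by rewrite -ejk mulrDr sgnD.
have -> : sgn R (ij * k) = sgn R (i * k) * sgn R (j * k).
  by rewrite -eij mulrDl sgnD.
have -> : sgn R (j * ik) = sgn R (i * j) * sgn R (j * k).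
  by rewrite -eik mulrDr sgnD (mulrC j i).
rewrite !linearB !ghom_compBl !linearZ !ghom_compZl /=.
rewrite -(ghom_compA eij ejk en1 en2) -(ghom_compA eji eik en3 en2).
rewrite -(ghom_compA ejk eki en3 en1') -(ghom_compA ekj eji en2' en1').
rewrite -(ghom_compA eik ekj en1 en3') -(ghom_compA eki eij en2' en3').
move: (sgnMM R (i * j)) {en1' en3'}.
move: (ghom_comp en1 a (ghom_comp ejk b c)) (ghom_comp en1 a (ghom_comp ekj c b)) => x1 x2.
move: (ghom_comp en3 b (ghom_comp eki c a)) (ghom_comp en3 b (ghom_comp eik a c)) => x3 y.
move: (ghom_comp en2' c (ghom_comp eij a b)) (ghom_comp en2' c (ghom_comp eji b a)) => z x4.
move: (sgn R (i * j)) (sgn R (i * k)) (sgn R (j * k)) => s1 s2 s3 s1s1.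
rewrite !(scalerN, opprK, scalerBr, scalerA).
rewrite !mulrA s1s1 mul1r -(mulrC s1) !mulrA opprB -[s2 * s3]mulrC.
have := jacobi_zmod x1 (s3 *: x2) ((s1 * s2) *: x3) ((s1 * s2 * s3) *: x4)
  (s1 *: y) ((s3 * s2) *: z).
rewrite opprB (opprB ((s3 * s2) *: z)) => ->.
by rewrite [_ *: x4 - _]addrC.
Qed.

Lemma gcomm_odd A m p q (h : m + m = p) (h' : m + p = q) (f : ghom A A m) :
  odd (absz m) -> gcomm h' f (gcomm h f f) = 0.
Proof.
move=> om; have h'' := addzC_subproof h'.
rewrite (gcommE h h) (gcommE h' h'') sgn_oddE; last by rewrite odd_abszM om.
rewrite scaleN1r opprK sgn_even; last first.
  by rewrite -h odd_abszM odd_abszD addbb andbF.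
by rewrite scale1r linearD /= ghom_compDl !(ghom_compA h h h' h'') subrr.
Qed.

End GradedHom.

Section HomDGL.
Variables (R : comPzRingType) (K : cochain_complex R).

Definition ghom_dif : ghom K K 1 :=
  @GHom R K K 1 (fun i j h => dif K h) (fun i j h => linearP (dif K h)).

Fact ghom_dif2 p (h : 1 + 1 = p) : ghom_comp h ghom_dif ghom_dif = 0.
Proof. by apply: ghomP => i j hij x; apply: dif_dif. Qed.

(* [d_K, phi], where d_K is viewed as an element of degree 1. *)
Definition hom_dif (m m' : int) (h : m + 1 = m') :
    {linear ghom K K m -> ghom K K m'} :=
  gcomm (addzC_subproof h) ghom_dif.

Fact hom_dif_dif (i j k : int) (ij : i + 1 = j) (jk : j + 1 = k)
    (phi : ghom K K i) :
  hom_dif jk (hom_dif ij phi) = 0.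
Proof.
rewrite /hom_dif /= (gcommE _ ij) (gcommE _ jk) linearB linearZ /=.
have e2 : (1 + 1 : int) + i = k by rewrite -jk -ij addrC addrA.
have e3 := addzC_subproof e2.
rewrite ghom_compBl ghom_compZl.
rewrite (ghom_compA erefl _ _ e2) -(ghom_compA ij erefl e3).
rewrite -(ghom_compA (addzC_subproof ij) ij (addzC_subproof jk) jk).
rewrite ghom_dif2 linear0 ghom_comp0l scaler0 subr0 sub0r.
have -> : sgn R (1 * j) = - sgn R (1 * i).
  by rewrite -ij !mul1r sgnD sgn1 mulrN1.
by rewrite scaleNr opprK addNr.
Qed.

Definition hom_complex : cochain_complex R :=
  @CochainComplex R (fun m : int => ghom K K m) hom_dif hom_dif_dif.

Fact hom_leibniz (i j k i' j' k' : int)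
    (ij : i + j = k) (kk' : k + 1 = k') (ii' : i + 1 = i') (jj' : j + 1 = j')
    (i'j : i' + j = k') (ij' : i + j' = k') (a : ghom K K i) (b : ghom K K j) :
  hom_dif kk' (gcomm ij a b)
  = gcomm i'j (hom_dif ii' a) b + sgn R i *: gcomm ij' a (hom_dif jj' b).
Proof. by rewrite -[i in sgn R i]mul1r; apply: gcomm_jacobi. Qed.

Definition hom_dgl : dglie R :=
  @DGLie R hom_complex (fun i j k h a b => @gcomm R K i j k h a b)
    (fun i j k h b => @gcomm_linearl R K i j k h b)
    (fun i j k h a => @gcomm_linearr R K i j k h a)
    (fun i j k h h' a b => @gcomm_anti R K i j k h h' a b)
    (fun i k h a => @gcomm_even R K i k h a)
    hom_leibniz (@gcomm_jacobi R K)
    (fun i j k h h' b => @gcomm_odd R K i j k h h' b).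

End HomDGL.

Section Koszul.
Variables (R : comPzRingType) (n : nat) (f : 'I_n -> R).

(* The exterior power of R^n in degree -m is free on the wedges               *)
(*   e_S = e_(i_1) /\ ... /\ e_(i_p),  S = {i_1 < ... < i_p},  p = -m,        *)
(* so an element is its family of coordinates x_S; the module is 0 if m > 0.  *)
(* The differential is d e_S = \sum_q (-1)^(q-1) f_(i_q) e_(S \ i_q), whence  *)
(* (d x)_T = \sum_(s notin T) (-1)^#{t in T, t < s} f_s x_(T + s).            *)
Definition kbasis (m : int) := {S : {set 'I_n} | - (#|S|%:Z) == m}.

Definition koszul_mod (m : int) : lmodType R := {ffun kbasis m -> R^o}.

(* The coordinate x_S, read as 0 when S does not have cardinal -m. *)
Definition kcoef m (x : koszul_mod m) (S : {set 'I_n}) : R :=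
  oapp x 0 (insub S).

Definition kdif_coef m (x : koszul_mod m) (T : {set 'I_n}) : R :=
  \sum_(s | s \notin T)
    (-1) ^+ #|[set t in T | (t < s)%N]| * f s * kcoef x (s |: T).

Definition kdif (i j : int) (h : i + 1 = j) (x : koszul_mod i) : koszul_mod j :=
  [ffun T : kbasis j => kdif_coef x (val T)].

Fact kcoef_linear m S : scalar (fun x : koszul_mod m => kcoef x S).
Proof.
move=> a x y; rewrite /kcoef; case: insub => [u|] /=; last first.
  by rewrite mulr0 addr0.
by rewrite !ffunE.
Qed.

Fact kdif_linear (i j : int) (h : i + 1 = j) : linear (kdif h).
Proof.
move=> a x y; apply/ffunP => T; rewrite !ffunE /kdif_coef scaler_sumr.
rewrite -big_split /=; apply: eq_bigr => s _.
by rewrite kcoef_linear mulrDr [a *: _]mulrCA.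
Qed.

HB.instance Definition _ (i j : int) (h : i + 1 = j) :=
  GRing.isLinear.Build R (koszul_mod i) (koszul_mod j) _ (kdif h)
    (kdif_linear h).

Lemma kcoef_kdif (i j : int) (h : i + 1 = j) (x : koszul_mod i) S :
  kcoef (kdif h x) S = kdif_coef x S.
Proof.
rewrite /kcoef; case: insubP => [u _ <-|Sj] /=; first by rewrite ffunE.
rewrite /kdif_coef big1 // => s sS; rewrite /kcoef insubN ?mulr0 //.
rewrite cardsU1 sS; apply: contra Sj => /eqP; lia.
Qed.

Lemma sum_antisym (F : 'I_n -> 'I_n -> R) :
  (forall s, F s s = 0) -> (forall s t, F s t = - F t s) ->
  \sum_s \sum_t F s t = 0.
Proof.
move=> F0 FN.
pose G (s t : 'I_n) := if (s < t)%N then F s t else 0.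
have FG s t : F s t = G s t - G t s.
  by rewrite /G; case: ltngtP => [_|_|/ord_inj->]; rewrite ?subr0 ?sub0r.
under eq_bigr do under eq_bigr do rewrite FG.
under eq_bigr do rewrite sumrB.
by rewrite sumrB [X in _ - X]exchange_big subrr.
Qed.

Fact kdif_kdif (i j k : int) (ij : i + 1 = j) (jk : j + 1 = k)
    (x : koszul_mod i) :
  kdif jk (kdif ij x) = 0.
Proof.
apply/ffunP => T; rewrite !ffunE; move: (val T) => {}T.
pose c (S : {set 'I_n}) (s : 'I_n) := #|[set t in S | (t < s)%N]|.
pose F (s t : 'I_n) := if [&& s \notin T, t \notin T & s != t] then
  (-1) ^+ (c T s + (c T t + (s < t)))%N * (f s * f t) * kcoef x (s |: (t |: T))
  else 0.
rewrite -[RHS](@sum_antisym F); first last.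
- move=> s t; rewrite /F (eq_sym t) setUCA [f t * _]mulrC.
  case: (s \notin T) => //=; last by rewrite andbF oppr0.
  case: (t \notin T) => //=; last by rewrite oppr0.
  case: eqVneq => [_|st] /=; first by rewrite oppr0.
  rewrite -!mulNr; congr (_ * _ * _).
  rewrite addnCA !exprD -!mulrN; congr (_ * (_ * _)).
  have : val s != val t by [].
  by case: ltngtP => //= _ _; rewrite ?opprK.
- by move=> s; rewrite /F eqxx !andbF.
rewrite /kdif_coef big_mkcond; apply: eq_bigr => s _.
case: ifPn => sT; last by rewrite big1 // => t _; rewrite /F (negbTE sT).
rewrite kcoef_kdif /kdif_coef big_distrr big_mkcond; apply: eq_bigr => t _ /=.
rewrite /F sT in_setU1 negb_or (eq_sym t) andbC /=.
case: ifP => // /andP[tT st].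
rewrite setUCA exprD !mulrA; congr (_ * _); rewrite -!mulrA; congr (_ * _).
rewrite mulrCA; congr (_ ^+ _ * _).
rewrite /c [RHS]addnC; case: ltnP => [lt_st|le_ts].
  rewrite (_ : [set u in s |: T | (u < t)%N]
            = s |: [set u in T | (u < t)%N]).
    by rewrite cardsU1 inE (negbTE sT).
  by apply/setP => u; rewrite !inE; case: eqVneq => // ->.
rewrite add0n; apply: eq_card => u; rewrite !inE; case: eqVneq => // ->.
by rewrite ltnNge le_ts !andbF.
Qed.

Definition koszul : cochain_complex R :=
  @CochainComplex R koszul_mod kdif kdif_kdif.

Definition generated_ideal (r : R) : Prop :=
  exists c : 'I_n -> R, r = \sum_(i < n) c i * f i.

End Koszul.

(* Main.v *)
From HB Require Import structures.
Require Import Defs.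
From mathcomp Require Import all_boot all_order all_algebra.
From mathcomp Require Import zify.

(* In a DG-Lie algebra let y and x be cocycles with [y, x] = d w, and let     *)
(* c x = d z for a scalar c.  Up to sign, [y, z] - c w is then a cocycle: a   *)
(* Massey-type secondary product, whose vanishing for a suitable w is         *)
(* invariant under quasi-isomorphisms and trivial for abelian algebras.  In   *)
(* the endomorphisms of the Koszul complex take for y the contraction by the  *)
(* first basis vector e, for z the exterior multiplication by e, for x the    *)
(* identity and c = f_0.  Then [y, z] = 1, so that vanishing would give       *)
(* 1 + f_0 w = [d, t], and evaluating at 1 in K^0 puts 1 in the ideal.        *)

Set Implicit Arguments.
Unset Strict Implicit.
Unset Printing Implicit Defensive.

Import GRing.Theory.
Local Open Scope ring_scope.

(** The condition [secondary_bracket_trivial] asks only for some primitive [w] of [y, x], so it does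
    not depend on choices and crosses a quasi-isomorphism both ways
    ([secondary_bracket_trivial_pull], [secondary_bracket_trivial_push]). Along a zigzag it
    therefore travels from the abelian end to the other end. On the Koszul side it suffices that the
    identity and [contract0] are cocycles, that [d, e /\ -] = f_0 ([wedge0_dif]), that [y, z] fixes
    1 ([contract0_wedge0]), and that d maps K^(-1) into the ideal ([kcoef_dif_ideal]). Conceptually,
    f_0 acts as zero on H^0(K) = R/(f), so 1 + f_0 w = [d, t] would force R/(f) = 0. *)

Section CochainComplex.
Variables (R : comPzRingType) (K : cochain_complex R).

Lemma cocycle0 (i : int) : cocycle (0 : K i).
Proof. by move=> j h; rewrite linear0. Qed.

Lemma cocycleZ (i : int) (c : R) (x : K i) : cocycle x -> cocycle (c *: x).
Proof. by move=> cx j h; rewrite linearZ /= cx scaler0. Qed.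

Lemma cocycle_eq (i j : int) (h : i + 1 = j) (x : K i) :
  dif K h x = 0 -> cocycle x.
Proof. by case: _ / h => x0 j' h'; case: _ / h'. Qed.

Lemma cohomologousP (i j : int) (h : j + 1 = i) (x y : K i) :
  cohomologous x y -> exists z, x - y = dif K h z.
Proof.
case=> j' [h' [z xy]]; have e : j' = j by apply: (addIr 1); rewrite h h'.
case: _ / e (h) => h1; exists z.
by rewrite (eq_irrelevance h1 h').
Qed.

End CochainComplex.

(** * Secondary products in a DG-Lie algebra *)

Section DGLie.
Variables (R : comPzRingType) (L : dglie R).

HB.instance Definition _ (i j k : int) (h : i + j = k) (a : L i) :=
  GRing.isLinear.Build R (L j) (L k) _ (brk h a) (brk_linearr h a).

Lemma brkDl (i j k : int) (h : i + j = k) (a a' : L i) (b : L j) :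
  brk h (a + a') b = brk h a b + brk h a' b.
Proof. by have := brk_linearl h b 1 a a'; rewrite !scale1r. Qed.

Lemma brk0l (i j k : int) (h : i + j = k) (b : L j) : brk h 0 b = 0.
Proof. by apply: (addrI (brk h 0 b)); rewrite -brkDl !addr0. Qed.

Section Leibniz.
Variables (i j k j' k' : int) (ij : i + j = k) (kk' : k + 1 = k').
Variables (jj' : j + 1 = j') (ij' : i + j' = k').

Lemma dif_brk_cocyclel (a : L i) (b : L j) : cocycle a ->
  dif L kk' (brk ij a b) = sgn R i *: brk ij' a (dif L jj' b).
Proof.
have i'j : i + 1 + j = k' by lia.
by move=> ca; rewrite (brk_leibniz ij kk' erefl jj' i'j ij') ca brk0l add0r.
Qed.

End Leibniz.

Lemma cocycle_brk (i j k : int) (h : i + j = k) (a : L i) (b : L j) :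
  cocycle a -> cocycle b -> cocycle (brk h a b).
Proof.
move=> ca cb k' h'; have e : i + (j + 1) = k' by lia.
by rewrite (dif_brk_cocyclel _ _ erefl e) // cb linear0 scaler0.
Qed.

(* [sgn R j] is the Leibniz sign in d [y, z] = sgn j [y, d z].                *)
Definition secondary_bracket_trivial :=
  forall (i' i j k'' k' k : int) (hi : i' + 1 = i) (hk : j + i = k)
    (hk' : j + i' = k') (dk' : k'' + 1 = k') (dk : k' + 1 = k)
    (c : R) (x : L i) (y : L j) (z : L i'),
  cocycle x -> cocycle y -> dif L hi z = c *: x ->
  exists w t, dif L dk w = brk hk y x /\
    brk hk' y z - (sgn R j * c) *: w = dif L dk' t.

Lemma abelian_secondary_bracket_trivial :
  abelian_dgl L -> secondary_bracket_trivial.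
Proof.
move=> abL i' i j k'' k' k hi hk hk' dk' dk c x y z _ _ _; exists 0, 0.
by rewrite !abL scaler0 subrr !linear0.
Qed.

End DGLie.

(** * Invariance under quasi-isomorphisms and zigzags *)

Section QuasiIso.
Variables (R : comPzRingType) (N L : dglie R) (f : dgl_morphism N L).

Lemma dgl_map_cocycle (i : int) (x : N i) : cocycle x -> cocycle (f i x).
Proof. by move=> cx j h; rewrite -dgl_map_dif cx linear0. Qed.

Hypothesis qf : quasi_iso f.

Lemma quasi_iso_inj (i j : int) (h : i + 1 = j) (x : N j) (t : L i) :
  cocycle x -> f j x = dif L h t -> exists u, x = dif N h u.
Proof.
move=> cx fx; have [inj _] := qf j.
have [|u] := @cohomologousP _ _ _ _ h x 0 (inj _ _ cx (@cocycle0 _ _ _) _).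
  by exists i, h, t; rewrite linear0 subr0.
by rewrite subr0 => ->; exists u.
Qed.

Lemma quasi_iso_surj (i j : int) (h : i + 1 = j) (y : L j) :
  cocycle y -> exists x t, cocycle x /\ f j x = y + dif L h t.
Proof.
move=> cy; have [_ surj] := qf j.
have [x cx /(cohomologousP h)[t e]] := surj _ cy.
by exists x, t; rewrite -e addrC subrK.
Qed.

(** Injectivity in cohomology gives exactness in [N] from exactness in [L], once the primitive of
    [y, x] in [N] is adjusted by a cocycle to match the one in [L]. *)
Lemma secondary_bracket_trivial_pull :
  secondary_bracket_trivial L -> secondary_bracket_trivial N.
Proof.
move=> trL i' i j k'' k' k hi hk hk' dk' dk c x y z cx cy dz.
set s := sgn R j.
have [||| w [t [dw dt]]] :=
  trL _ _ _ _ _ _ hi hk hk' dk' dk c (f _ x) (f _ y) (f _ z).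
- exact: dgl_map_cocycle.
- exact: dgl_map_cocycle.
- by rewrite -dgl_map_dif dz linearZ.
have [|w1 dw1] := @quasi_iso_inj _ _ dk (brk hk y x) w (cocycle_brk hk cy cx).
  by rewrite dgl_map_brk dw.
have cw : cocycle (f _ w1 - w).
  apply: (@cocycle_eq _ _ _ _ dk).
  by rewrite linearB -dgl_map_dif -dw1 dgl_map_brk dw subrr.
(* Subtracting [u] makes the image of the primitive equal to [w] up to the coboundary of [r]. *)
have [u [r [cu fu]]] := quasi_iso_surj dk' cw.
have dw2 : dif N dk (w1 - u) = brk hk y x by rewrite linearB cu subr0 -dw1.
have [||t' dt'] := @quasi_iso_inj _ _ dk'
  (brk hk' y z - (s * c) *: (w1 - u)) (t + (s * c) *: r).
- apply: (@cocycle_eq _ _ _ _ dk).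
  rewrite linearB linearZ /= dw2 (dif_brk_cocyclel _ _ hi hk) // dz linearZ /=.
  by rewrite scalerA subrr.
- rewrite linearB linearZ dgl_map_brk linearB fu /=.
  rewrite opprD opprB addrA (addrCA (f _ w1)) subrr addr0.
  rewrite linearD -dt -scalerN opprB scalerBr addrA addrAC.
  by rewrite [dif _ _ (_ *: r)]linearZ.
by exists (w1 - u), t'.
Qed.

(** The data lift to [N] only up to coboundaries: x + da, y + db and z + c a + dr. The errors these
    introduce in the two brackets have explicit primitives, by Leibniz. *)
Lemma secondary_bracket_trivial_push :
  secondary_bracket_trivial N -> secondary_bracket_trivial L.
Proof.
move=> trN i' i j k'' k' k hi hk hk' dk' dk c x y z cx cy dz.
set s := sgn R j.
have ss : s * s = 1 by apply: sgnMM.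
have hi1 : (i' - 1) + 1 = i' by lia.
have hj : (j - 1) + 1 = j by lia.
have [x' [a [cx' fx]]] := quasi_iso_surj hi cx.
have [y' [b [cy' fy]]] := quasi_iso_surj hj cy.
(* The image of c x' is d(z + c a), so c x' is already exact in [N]; its primitive is then corrected
   by a cocycle [u]. *)
have [|z1 dz1] := @quasi_iso_inj _ _ hi (c *: x') (z + c *: a) (cocycleZ c cx').
  by rewrite linearD !linearZ /= dz fx scalerDr.
have cz : cocycle (f _ z1 - (z + c *: a)).
  apply: (@cocycle_eq _ _ _ _ hi).
  by rewrite linearB -dgl_map_dif -dz1 linearD !linearZ /= dz fx scalerDr subrr.
have [u [r0 [cu fu]]] := quasi_iso_surj hi1 cz.
pose r := - r0.
have dz' : dif N hi (z1 - u) = c *: x' by rewrite linearB cu subr0 -dz1.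
have fz : f _ (z1 - u) = z + c *: a + dif L hi1 r.
  by rewrite linearB fu opprD opprB addrA (addrCA (f _ z1)) subrr addr0 linearN.
have [w [t [dw dt]]] := trN _ _ _ _ _ _ hi hk hk' dk' dk c x' y' _ cx' cy' dz'.
have bX : (j - 1) + i = k' by lia.
have bX' : (j - 1) + (i + 1) = k by lia.
have bZ : (j - 1) + i' = k'' by lia.
have yr : j + (i' - 1) = k'' by lia.
have db : sgn R (j - 1) = - s.
  by rewrite /s -[in RHS](subrK 1 j) [in RHS]sgnD sgn1 mulrN1 opprK.
move: (z1 - u) dz' fz w t dw dt => z' dz' fz w t dw dt.
(* The corrections are primitives of the extra terms in [y + db, x + da] and [y + db, z + c a + dr].
   Since d[b, f z'] also contains - s c [b, f x'], the term [b, f x'] of the first witness is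
   absorbed. *)
exists (f _ w - s *: brk hk' y a - brk bX b (f _ x')),
  (f _ t - brk bZ b (f _ z') - s *: brk yr y r); split.
- rewrite !linearB linearZ /= -dgl_map_dif dw dgl_map_brk.
  rewrite (dif_brk_cocyclel _ _ hi hk) // scalerA ss scale1r.
  rewrite (brk_leibniz bX dk hj erefl hk bX').
  rewrite (dgl_map_cocycle cx') linear0 scaler0 addr0 fy brkDl addrAC addrK.
  by rewrite fx linearD addrK.
have brYZ : brk hk' (f _ y') (f _ z')
    = brk hk' y z + c *: brk hk' y a + brk hk' y (dif L hi1 r)
      + brk hk' (dif L hj b) (f _ z').
  by rewrite fy brkDl {1}fz !linearD linearZ.
have dbZ : dif L dk' (brk bZ b (f _ z'))
    = brk hk' (dif L hj b) (f _ z') - (s * c) *: brk bX b (f _ x').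
  rewrite (brk_leibniz bZ dk' hj hi hk' bX) -dgl_map_dif dz' db.
  by rewrite !linearZ /= scaleNr !scalerN scalerA mulrC.
have dyr : dif L dk' (s *: brk yr y r) = brk hk' y (dif L hi1 r).
  by rewrite linearZ /= (dif_brk_cocyclel _ _ hi1 hk') // scalerA ss scale1r.
have dft : dif L dk' (f _ t) = brk hk' (f _ y') (f _ z') - (s * c) *: f _ w.
  by rewrite -dgl_map_dif -dt linearB linearZ dgl_map_brk.
rewrite [RHS]linearB [dif _ _ (_ - _)]linearB dft dbZ dyr brYZ.
rewrite scalerBr scalerBr scalerA (mulrAC s) ss mul1r.
move: (brk hk' y z) (c *: brk hk' y a) (brk hk' y (dif L hi1 r))
  (brk hk' (dif L hj b) (f _ z'))
  ((s * c) *: f _ w) ((s * c) *: brk bX b (f _ x')).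
move=> A B C D E F; rewrite !opprB [_ + (F - D)]addrA (addrAC _ D (- E)).
rewrite (addrAC _ D F) addrK (addrAC _ F) (addrAC _ C) addrK.
by rewrite (addrC F) !addrA.
Qed.

End QuasiIso.

Lemma zigzag_secondary_bracket_trivial (R : comPzRingType) (L M : dglie R) :
  qi_zigzag L M -> secondary_bracket_trivial M -> secondary_bracket_trivial L.
Proof.
elim=> {L M} [L M N f g qf qg|L M N L' f g qf qg _ IH] trM.
  exact: secondary_bracket_trivial_push qf
    (secondary_bracket_trivial_pull qg trM).
exact: secondary_bracket_trivial_push qf
  (secondary_bracket_trivial_pull qg (IH trM)).
Qed.

Lemma homotopy_abelian_secondary_bracket_trivial (R : comPzRingType)
    (L : dglie R) :
  homotopy_abelian L -> secondary_bracket_trivial L.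
Proof.
case=> M abM LM; apply: zigzag_secondary_bracket_trivial LM _.
exact: abelian_secondary_bracket_trivial.
Qed.

(** * Coordinates on the Koszul complex and its identity endomorphism *)

Section KoszulCoordinates.
Variables (R : comPzRingType) (n : nat) (f : 'I_n -> R).
Local Notation K := (koszul f).
Implicit Types (m i j : int) (S T : {set 'I_n}).

Lemma kcoef_ffun m (g : {set 'I_n} -> R) S :
  (- (#|S|%:Z) != m -> g S = 0) ->
  kcoef ([ffun T : kbasis _ m => g (val T)] : koszul_mod R n m) S = g S.
Proof.
rewrite /kcoef; case: insubP => [u _ <- _|Sm gS] /=; first by rewrite ffunE.
by rewrite gS.
Qed.

Lemma kcoef_card m (x : koszul_mod R n m) S :
  - (#|S|%:Z) != m -> kcoef x S = 0.
Proof. by move=> Sm; rewrite /kcoef insubN. Qed.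

Lemma kcoefP m (x y : koszul_mod R n m) :
  (forall S, kcoef x S = kcoef y S) -> x = y.
Proof.
by move=> xy; apply/ffunP => S; have := xy (val S); rewrite /kcoef valK.
Qed.

Lemma kcoefD m (x y : koszul_mod R n m) S :
  kcoef (x + y) S = kcoef x S + kcoef y S.
Proof. by have := kcoef_linear S 1 x y; rewrite scale1r mul1r. Qed.

Lemma kcoef0 m S : kcoef (0 : koszul_mod R n m) S = 0.
Proof.
by apply: (addrI (kcoef (0 : koszul_mod R n m) S)); rewrite -kcoefD !addr0.
Qed.

Lemma kcoefZ m (a : R) (x : koszul_mod R n m) S :
  kcoef (a *: x) S = a * kcoef x S.
Proof. by have := kcoef_linear S a x 0; rewrite kcoef0 !addr0. Qed.

Lemma kcoefB m (x y : koszul_mod R n m) S :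
  kcoef (x - y) S = kcoef x S - kcoef y S.
Proof. by rewrite -scaleN1r kcoefD kcoefZ mulN1r. Qed.

Definition kdif_sign T (s : 'I_n) : R := (-1) ^+ #|[set t in T | (t < s)%N]|.

Lemma kdif_coefE m (x : koszul_mod R n m) T :
  kdif_coef f x T
  = \sum_(s | s \notin T) kdif_sign T s * f s * kcoef x (s |: T).
Proof. by []. Qed.

(** The coordinate at the empty set is K^0 = R, where d sends e_s to f_s. *)
Lemma kcoef_dif_ideal i j (h : i + 1 = j) (x : K i) :
  generated_ideal f (kcoef (dif K h x) set0).
Proof.
rewrite kcoef_kdif kdif_coefE.
exists (fun s => kdif_sign set0 s * kcoef x (s |: set0)).
by apply: eq_big => s; rewrite ?inE // => _; rewrite mulrAC.
Qed.

(* A degree 0 map K i -> K j only comes with a proof of i + 0 = j; passing    *)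
(* through coordinates avoids a transport.                                    *)
Fact id_ghom_linear i j (h : i + 0 = j) :
  linear (fun x : K i => [ffun T : kbasis _ j => kcoef x (val T)] : K j).
Proof.
by move=> a x y; apply/ffunP => T; rewrite !ffunE kcoefD kcoefZ.
Qed.

Definition id_ghom : ghom K K 0 := GHom id_ghom_linear.

Lemma kcoef_id i j (h : i + 0 = j) (x : K i) S :
  kcoef (id_ghom i j h x) S = kcoef x S.
Proof.
rewrite kcoef_ffun // => Sj; apply: kcoef_card; apply: contra Sj => /eqP; lia.
Qed.

Lemma id_ghom_dif j (h : 0 + 1 = j) : hom_dif K h id_ghom = 0.
Proof.
rewrite /hom_dif /= (gcommE _ h); apply: ghomP => i k hik x; apply: kcoefP => S.
have h1 : i + 0 + 1 = k by lia.
have h2 : i + 1 + 0 = k by lia.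
rewrite kcoef0 kcoefB kcoefZ.
rewrite (ghom_compE _ _ _ erefl h1) (ghom_compE _ _ _ erefl h2).
rewrite kcoef_id /= !kcoef_kdif.
have -> : sgn R (1 * 0) = 1 by [].
rewrite mul1r; apply/eqP; rewrite subr_eq0; apply/eqP.
by apply: eq_bigr => s _; rewrite kcoef_id.
Qed.

End KoszulCoordinates.

(** * Contraction and multiplication by the first basis vector *)

Section FirstBasisVector.
Variables (R : comPzRingType) (n : nat) (f : 'I_n.+1 -> R).
Local Notation K := (koszul f).
Implicit Types (m i j : int) (S T : {set 'I_n.+1}).
Local Notation kdif_sign := (kdif_sign R).

Lemma card_setD1_ord0 (S : {set 'I_n.+1}) :
  ord0 \in S -> #|S| = #|S :\ ord0|.+1.
Proof. by move=> S0; rewrite (cardsD1 ord0) S0. Qed.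

(* The contraction by e_0^* and the product by e_0: no sign appears in        *)
(* coordinates because 0 precedes every other index.                          *)
Definition contract0_coef m (x : koszul_mod R n.+1 m) T : R :=
  if ord0 \in T then 0 else kcoef x (ord0 |: T).

Definition wedge0_coef m (x : koszul_mod R n.+1 m) T : R :=
  if ord0 \in T then kcoef x (T :\ ord0) else 0.

Definition contract0_fun i j (h : i + 1 = j) (x : K i) : K j :=
  [ffun T : kbasis _ j => contract0_coef x (val T)].

Definition wedge0_fun i j (h : i + -1 = j) (x : K i) : K j :=
  [ffun T : kbasis _ j => wedge0_coef x (val T)].

Lemma kcoef_contract0 i j (h : i + 1 = j) (x : K i) S :
  kcoef (contract0_fun h x) S = contract0_coef x S.
Proof.
apply: kcoef_ffun => Sj; rewrite /contract0_coef; case: ifPn => // S0.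
by apply: kcoef_card; rewrite cardsU1 S0; apply: contra Sj => /eqP; lia.
Qed.

Lemma kcoef_wedge0 i j (h : i + -1 = j) (x : K i) S :
  kcoef (wedge0_fun h x) S = wedge0_coef x S.
Proof.
apply: kcoef_ffun => Sj; rewrite /wedge0_coef; case: ifPn => // S0.
apply: kcoef_card; move: Sj; rewrite (card_setD1_ord0 S0).
by apply: contra => /eqP; lia.
Qed.

Fact contract0_linear i j (h : i + 1 = j) : linear (contract0_fun h).
Proof.
move=> a x y; apply: kcoefP => S.
rewrite kcoefD kcoefZ !kcoef_contract0 /contract0_coef kcoefD kcoefZ.
by case: ifP => // _; rewrite mulr0 addr0.
Qed.

Fact wedge0_linear i j (h : i + -1 = j) : linear (wedge0_fun h).
Proof.
move=> a x y; apply: kcoefP => S.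
rewrite kcoefD kcoefZ !kcoef_wedge0 /wedge0_coef kcoefD kcoefZ.
by case: ifP => // _; rewrite mulr0 addr0.
Qed.

Definition contract0 : ghom K K 1 := GHom contract0_linear.
Definition wedge0 : ghom K K (-1) := GHom wedge0_linear.

Lemma kdif_sign0 T : kdif_sign T ord0 = 1.
Proof.
rewrite /kdif_sign (_ : [set _ in _ | _] = set0) ?cards0 //.
by apply/setP=> t; rewrite !inE andbF.
Qed.

(** The index 0 lies below [s], so it adds one to the count. *)
Lemma kdif_signU0 T s : s != ord0 -> ord0 \notin T ->
  kdif_sign (ord0 |: T) s = - kdif_sign T s.
Proof.
move=> s0 T0; rewrite /kdif_sign.
rewrite (_ : [set t in ord0 |: T | _] = ord0 |: [set t in T | (t < s)%N]).
  by rewrite cardsU1 inE (negbTE T0) exprS mulN1r.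
apply/setP=> t; rewrite !inE; case: eqVneq => // -> /=.
by rewrite lt0n.
Qed.

(** The Koszul differential is itself the contraction by the form with values f_i, and contractions
    by 1-forms anticommute. *)
Lemma contract0_dif j (h : 1 + 1 = j) : hom_dif K h contract0 = 0.
Proof.
rewrite /hom_dif /= (gcommE _ h); apply: ghomP => i k hik x; apply: kcoefP => S.
have h1 : i + 1 + 1 = k by lia.
rewrite kcoef0 kcoefB kcoefZ !(ghom_compE _ _ _ erefl h1) /=.
rewrite !(kcoef_kdif, kcoef_contract0) kdif_coefE /contract0_coef.
rewrite kcoef_kdif kdif_coefE.
have -> : sgn R (1 * 1) = -1 by [].
rewrite mulN1r opprK; case: ifPn => S0.
  rewrite addr0 big1 // => s sS.
  by rewrite kcoef_contract0 /contract0_coef in_setU1 S0 orbT mulr0.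
rewrite (bigD1 ord0) //= kcoef_contract0 /contract0_coef setU11 mulr0 add0r.
rewrite (eq_bigl (fun s => s \notin ord0 |: S)); last first.
  by move=> s; rewrite in_setU1 negb_or andbC.
rewrite -big_split big1 // => s /=; rewrite in_setU1 negb_or => /andP[s0 sS].
rewrite kcoef_contract0 /contract0_coef in_setU1 eq_sym.
rewrite (negbTE s0) (negbTE S0) /= setUCA kdif_signU0 //.
by rewrite !mulNr subrr.
Qed.

(** This is the Leibniz rule d(e_0 /\ x) = f_0 x - e_0 /\ dx: multiplication by e_0 is a homotopy
    from f_0 to zero. *)
Lemma wedge0_dif (h : -1 + 1 = 0) : hom_dif K h wedge0 = f ord0 *: id_ghom f.
Proof.
rewrite /hom_dif /= (gcommE _ h); apply: ghomP => i k hik x; apply: kcoefP => S.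
have h1 : i + -1 + 1 = k by lia.
have h2 : i + 1 + -1 = k by lia.
rewrite [RHS]kcoefZ kcoef_id kcoefB kcoefZ.
rewrite (ghom_compE _ _ _ erefl h1) (ghom_compE _ _ _ erefl h2) /=.
rewrite kcoef_kdif kcoef_wedge0 kdif_coefE /wedge0_coef kcoef_kdif kdif_coefE.
have -> : sgn R (1 * -1) = -1 by [].
rewrite mulN1r opprK; case: ifPn => S0; last first.
  rewrite addr0 (bigD1 ord0) //= kcoef_wedge0 /wedge0_coef setU11 setU1K //.
  rewrite big1 ?addr0 => [|s /andP[sS s0]]; first by rewrite kdif_sign0 mul1r.
  rewrite kcoef_wedge0 /wedge0_coef in_setU1 eq_sym.
  by rewrite (negbTE s0) (negbTE S0) mulr0.
(* In e_0 /\ dx the index 0 contributes f_0 x_S; the other indices cancel against d(e_0 /\ x). *)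
rewrite [X in _ + X](bigD1 ord0) /=; last by rewrite !inE eqxx.
rewrite setD1K // kdif_sign0 mul1r addrCA.
rewrite [X in _ + (_ + X)](eq_bigl (fun s => s \notin S)); last first.
  move=> s; rewrite !inE; case: eqVneq => [->|] //=; last by rewrite andbT.
  by rewrite S0.
rewrite -big_split big1 ?addr0 // => s sS /=.
have s0 : s != ord0 by apply: contraNneq sS => ->.
rewrite kcoef_wedge0 /wedge0_coef in_setU1 S0 orbT.
rewrite -{1}(setD1K S0) kdif_signU0 ?inE ?eqxx //.
rewrite (_ : (s |: S) :\ ord0 = s |: S :\ ord0) ?mulNr ?addNr //.
rewrite setDUl; congr (_ :|: _); apply/setP => t; rewrite !inE.
by case: (t =P s) => [->|]; rewrite ?s0 ?andbF.
Qed.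

(** Contracting e_0 /\ x gives x back, and the other composite has no coordinate at the empty set,
    since multiples of e_0 involve only sets containing 0. *)
Lemma contract0_wedge0 (h : 1 + -1 = 0) (h0 : 0 + 0 = 0 :> int) (x : K 0) :
  kcoef (gcomm h contract0 wedge0 0 0 h0 x) set0 = kcoef x set0.
Proof.
rewrite (gcommE _ (addzC_subproof h)) kcoefB kcoefZ.
rewrite (ghom_compE _ _ _ erefl (erefl : 0 + -1 + 1 = 0 :> int)).
rewrite (ghom_compE _ _ _ erefl (erefl : 0 + 1 + -1 = 0 :> int)) /=.
rewrite kcoef_contract0 /contract0_coef inE kcoef_wedge0 /wedge0_coef.
rewrite setU11 setU1K ?inE // kcoef_wedge0 /wedge0_coef inE.
by rewrite mulr0 subr0.
Qed.

End FirstBasisVector.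

(** * Ideal membership and the contradiction *)

Section GeneratedIdeal.
Variables (R : comPzRingType) (n : nat) (f : 'I_n -> R).

Lemma generated_idealD (a b : R) :
  generated_ideal f a -> generated_ideal f b -> generated_ideal f (a + b).
Proof.
move=> [c ->] [c' ->]; exists (fun i => c i + c' i).
by rewrite -big_split; apply: eq_bigr => i _; rewrite mulrDl.
Qed.

Lemma generated_idealM (a b : R) :
  generated_ideal f b -> generated_ideal f (a * b).
Proof.
move=> [c ->]; exists (fun i => a * c i).
by rewrite mulr_sumr; apply: eq_bigr => i _; rewrite mulrA.
Qed.

Lemma generated_ideal_gen (i : 'I_n) : generated_ideal f (f i).
Proof.
exists (fun j => (j == i)%:R); rewrite (bigD1 i) //= eqxx mul1r.
by rewrite big1 ?addr0 // => j /negbTE->; rewrite mul0r.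
Qed.

End GeneratedIdeal.

Theorem corollary1p8 (R : comPzRingType) (n : nat) (f : 'I_n -> R)
    (n_gt0 : (0 < n)%N)
    (f_proper : ~ (forall r : R, generated_ideal f r)) :
  ~ homotopy_abelian (hom_dgl (koszul f)).
Proof.
case: n f n_gt0 f_proper => // n f _ f_proper.
move=> /homotopy_abelian_secondary_bracket_trivial trH; apply: f_proper => r.
have h01 : 0 + 1 = 1 :> int by [].
have hm1 : -1 + 1 = 0 :> int by [].
have hk' : 1 + -1 = 0 :> int by [].
have h00 : 0 + 0 = 0 :> int by [].
have hm11 : 0 + -1 + 1 = 0 :> int by [].
(* As [sgn R 1] is -1, [wt] reads [y, z] + f_0 w = [d, t]. *)
have [||| w [t [_ wt]]] := trH (-1) 0 1 (-1) 0 1 hm1 erefl hk' hm1 h01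
  (f ord0) (id_ghom f) (contract0 f) (wedge0 f).
- exact: (@cocycle_eq _ (hom_complex _) _ _ h01 _ (id_ghom_dif f h01)).
- exact: (@cocycle_eq _ (hom_complex _) _ _ erefl _ (contract0_dif f erefl)).
- exact: wedge0_dif.
(* Only the empty set indexes K^0, so this is its generator; its differential vanishes because K^1 =
   0. *)
pose one : koszul f 0 := [ffun => 1].
have one0 : kcoef one set0 = 1.
  by rewrite (@kcoef_ffun _ _ _ (fun=> 1)) // cards0.
have Done (h : 0 + 1 = 1 :> int) : dif (koszul f) h one = 0.
  apply: kcoefP => S; rewrite kcoef0; apply: kcoef_card; lia.
have := congr1 (fun g : ghom _ _ 0 => kcoef (g 0 0 h00 one) set0) wt.
rewrite kcoefB contract0_wedge0 one0.
(* At 1, [d, t] reduces to d(t(1)), which lies in the ideal, as does f_0 w(1); hence so does 1. *)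
rewrite -[dif _ hm1 t]/(gcomm (addzC_subproof hm1) (ghom_dif _) t).
rewrite (gcommE _ hm1) kcoefB !kcoefZ.
rewrite (ghom_compE _ _ _ (erefl (0 + -1)) hm11) (ghom_compE _ _ _ h01 hk') /=.
rewrite Done linear0 kcoef0 mulr0 subr0 => /eqP.
rewrite subr_eq => /eqP e1; rewrite -[r]mulr1 e1; apply: generated_idealM.
apply: generated_idealD; first exact: kcoef_dif_ideal.
rewrite mulrAC; apply: generated_idealM; exact: generated_ideal_gen.
Qed.
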